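(* Let $\hat\pi\in(0,1)$, $\epsilon\in(0,1)$ with $\epsilon<1-\hat\pi$, $\bar\lambda\ge 0$, and let $f_0,f_1$ be probability densities of two distinct distributions with $0<D(f_0\|f_1)<\infty$ and $0<D(f_1\|f_0)<\infty$. Let $C(\delta_L,\delta_U)$ be the cost function defined in the context. Then for every fixed $\hat\delta_L\in(0,1)$ the function $\delta_U\mapsto C(\hat\delta_L,\delta_U)$ is monotonically increasing on $[1,\infty)$. Consequently, for any solution $(\delta_L^*,\delta_U^* )$ of the problem $$\text{minimize } C(\delta_L,\delta_U)\quad\text{subject to}\quad \delta_U\ge \frac{1-\hat\pi}{\hat\pi}\,\frac{1-\epsilon}{\epsilon},\qquad \delta_L\in[0,1],$$ one has $$\delta_U^*=\frac{1-\hat\pi}{\hat\pi}\,\frac{1-\epsilon}{\epsilon}.$$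
   Context: $D(f\|g)=\mathbb{E}_{x\sim f}\left[\log\frac{f(x)}{g(x)}\right]$ denotes the Kullback-Leibler divergence, and $\log$ is the natural logarithm. The cost function is, for $0<\delta_L<1\le\delta_U$, $$C(\delta_L,\delta_U)=\frac{1-\hat\pi}{-D(f_0\|f_1)}\cdot\frac{\log(\delta_U)+\frac{\delta_U-1}{1-\delta_L}\log(\delta_L)}{1+\hat\pi(\delta_U-1)}+\frac{\hat\pi}{D(f_1\|f_0)}\cdot\frac{\delta_U\log(\delta_U)+\delta_L\frac{\delta_U-1}{1-\delta_L}\log(\delta_L)}{1+\hat\pi(\delta_U-1)}+\frac{\bar\lambda\,\frac{\delta_U-\delta_L}{1-\delta_L}}{1+\hat\pi(\delta_U-1)}.$$ At the endpoints $\delta_L=0$ and $\delta_L=1$, for $\delta_U>1$, $C(\delta_L,\delta_U)$ is understood as its one-sided limit in $\delta_L$, with values in $(-\infty,+\infty]$. Interpretation (not needed for the claim): $\hat\pi$ is the prior probability that a data stream is a target (density $f_1$ rather than $f_0$), $\epsilon$ is the tolerated error probability, $\bar\lambda$ is the mean switching cost, and $\delta_L,\delta_U$ are the exponentials of the lower and upper decision thresholds. *)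

(* Defs.v *)
From HB Require Import structures.
From mathcomp Require Import all_boot all_order all_algebra.
From mathcomp Require Import all_classical all_reals all_analysis.
Set Implicit Arguments.
Unset Strict Implicit.
Unset Printing Implicit Defensive.
Import Order.TTheory GRing.Theory Num.Theory.
Import numFieldNormedType.Exports.
Local Open Scope classical_set_scope.
Local Open Scope ring_scope.

Definition is_density (d : measure_display) (T : measurableType d)
    (R : realType) (mu : {measure set T -> \bar R}) (f : T -> R) : Prop :=
  [/\ measurable_fun [set: T] f, (forall x, 0 <= f x) &
      (\int[mu]_x (f x)%:E = 1)%E].

Definition distribution_of_density (d : measure_display) (T : measurableType d)
    (R : realType) (mu : {measure set T -> \bar R}) (f : T -> R)
    (A : set T) : \bar R :=
  (\int[mu]_(x in A) (f x)%:E)%E.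

(* The quotient and [lne] are those of [\bar R], where 0^-1 = +oo,
   0 * +oo = 0, lne 0 = -oo and lne +oo = +oo. Points with f x = 0 therefore
   contribute 0, and points with f x > 0 = g x contribute +oo. *)
Definition KL (d : measure_display) (T : measurableType d) (R : realType)
    (mu : {measure set T -> \bar R}) (f g : T -> R) : \bar R :=
  (\int[mu]_x ((f x)%:E * lne ((f x)%:E / (g x)%:E)))%E.

(* The closed formula for the cost, meaningful for 0 < dL < 1 <= dU and
   finite nonzero divergences. *)
Definition cost_formula (d : measure_display) (T : measurableType d)
    (R : realType) (mu : {measure set T -> \bar R}) (f0 f1 : T -> R)
    (p lambda dL dU : R) : R :=
  (1 - p) / (- fine (KL mu f0 f1)) *
    ((ln dU + (dU - 1) / (1 - dL) * ln dL) / (1 + p * (dU - 1)))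
  + p / fine (KL mu f1 f0) *
    ((dU * ln dU + dL * ((dU - 1) / (1 - dL)) * ln dL) / (1 + p * (dU - 1)))
  + lambda * ((dU - dL) / (1 - dL)) / (1 + p * (dU - 1)).

(* At dL = 0 and dL = 1 the cost is the one-sided limit of the closed formula,
   taken in \bar R because it may be +oo. *)
Definition cost (d : measure_display) (T : measurableType d)
    (R : realType) (mu : {measure set T -> \bar R}) (f0 f1 : T -> R)
    (p lambda dL dU : R) : \bar R :=
  let C := cost_formula mu f0 f1 p lambda in
  if dL == 0 then lim ((C x dU)%:E @[x --> 0^'+])
  else if dL == 1 then lim ((C x dU)%:E @[x --> 1^'-])
  else (C dL dU)%:E.

Definition feasible (R : realType) (p eps dL dU : R) : Prop :=
  (1 - p) / p * ((1 - eps) / eps) <= dU /\ 0 <= dL <= 1.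

Definition is_solution (d : measure_display) (T : measurableType d)
    (R : realType) (mu : {measure set T -> \bar R}) (f0 f1 : T -> R)
    (p eps lambda dL dU : R) : Prop :=
  feasible p eps dL dU /\
  forall dL' dU' : R, feasible p eps dL' dU' ->
    (cost mu f0 f1 p lambda dL dU <= cost mu f0 f1 p lambda dL' dU')%E.

(* Main.v *)
Require Import Defs.
From HB Require Import structures.
From mathcomp Require Import all_boot all_order all_algebra.
From mathcomp Require Import all_classical all_reals all_analysis.
From mathcomp Require Import ring lra.
Set Implicit Arguments.
Unset Strict Implicit.
Unset Printing Implicit Defensive.
Import Order.TTheory GRing.Theory Num.Theory.
Import numFieldNormedType.Exports.
Local Open Scope classical_set_scope.
Local Open Scope ring_scope.

(** For fixed [dL] every summand of the cost is a quotient N(u) / D(u) with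
    D(u) = 1 + p (u - 1), and depends on [dL] only through three numbers:
    c = - ln dL / (1 - dL), e = dL c and m = 1 / (1 - dL). In these terms the
    numerators are multiples of
      c (u - 1) - ln u,   u ln u - e (u - 1),   1 + m (u - 1),
    with positive factors for the first two and the factor lambda >= 0 for the
    third.
    The inequality ln x <= x - 1, applied to dL and to 1 / dL, gives
    c >= 1 >= e (lemmas [lowslope_ge1] and [lowslope_mul_le1]), and m >= p is
    clear. Under these bounds each quotient increases on [1, +oo[: after
    cross-multiplication only the chord bounds
    (v - u) / v < ln v - ln u < (v - u) / u are used
    (lemma [reduced_cost_increasing]). These chord bounds are strict, so the
    first two quotients increase strictly even when c = 1 = e.

    For the minimization the constraint reads u >= b with b > 1, because
    eps < 1 - p. Moving from u > b down to b lowers the cost strictly when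
    0 < dL < 1. At dL = 0 the cost is +oo, since c tends to +oo while the two
    other summands stay nonnegative; at dL = 1 it is +oo when lambda > 0,
    since m tends to +oo. Neither can be optimal, as finite costs are feasible.
    The remaining case dL = 1, lambda = 0 has c and e both tending to 1, so the
    limit is again of the reduced form, with c = e = 1, and the same
    monotonicity applies. *)

(** * Chord bounds for the logarithm *)

Lemma ln_lt_subr1 (R : realType) (x : R) : 0 < x -> x != 1 -> ln x < x - 1.
Proof.
move=> x0 x1; have lnx0 : ln x != 0 by rewrite ln_eq0.
by have := expR_gt1Dx lnx0; rewrite lnK ?posrE//; lra.
Qed.

Lemma ln_chord_lt (R : realType) (u v : R) : 0 < u -> u < v ->
  u * (ln v - ln u) < v - u.
Proof.
move=> u0 uv; have v0 : 0 < v by lra.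
rewrite -ln_div ?posrE//.
have -> : v - u = u * (v / u - 1) by field; lra.
rewrite ltr_pM2l// ln_lt_subr1 ?divr_gt0// gt_eqF//.
by rewrite ltr_pdivlMr// mul1r.
Qed.

Lemma ln_chord_gt (R : realType) (u v : R) : 0 < u -> u < v ->
  v - u < v * (ln v - ln u).
Proof.
move=> u0 uv; have v0 : 0 < v by lra.
suff : v * (ln u - ln v) < u - v by lra.
rewrite -ln_div ?posrE//.
have -> : u - v = v * (u / v - 1) by field; lra.
rewrite ltr_pM2l// ln_lt_subr1 ?divr_gt0// lt_eqF//.
by rewrite ltr_pdivrMr// mul1r.
Qed.

Lemma mulr_ln_ge_subr1 (R : realType) (u : R) : 1 <= u -> u - 1 <= u * ln u.
Proof.
rewrite le_eqVlt => /predU1P[<-|u1]; first by rewrite ln1; lra.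
by have := @ln_chord_gt R 1 u ltr01 u1; rewrite ln1; lra.
Qed.

(** * Monotonicity in the upper threshold *)

(** The cost with the dependence on the lower threshold abstracted into [c],
    [e] and [m]; [A] and [B] are the inverses of the two divergences. The
    abstraction lets one inequality serve both the interior [dL] and the limit
    [dL -> 1], where the formula itself is meaningless. *)
Definition reduced_cost (R : realType) (p A B lambda c e m u : R) : R :=
  ((1 - p) * A * (c * (u - 1) - ln u) + p * B * (u * ln u - e * (u - 1))
   + lambda * (1 + m * (u - 1))) / (1 + p * (u - 1)).

Lemma mixture_gt0 (R : realType) (p u : R) : 0 < p -> 1 <= u ->
  0 < 1 + p * (u - 1).
Proof.
move=> p0 u1; have : 0 <= p * (u - 1) by rewrite mulr_ge0//; lra.
lra.
Qed.

(** Cross-multiplying gives, with t = ln v - ln u, the excess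
    c (v - u) - t (1 + p (u - 1)) + p (ln u) (v - u), and 1 + p (u - 1) <= u
    together with u t < v - u makes it positive as soon as c >= 1. *)
Lemma cross_type0_lt (R : realType) (p c u v : R) : 0 < p < 1 -> 1 <= c ->
  1 <= u -> u < v ->
  (c * (u - 1) - ln u) * (1 + p * (v - 1)) <
  (c * (v - 1) - ln v) * (1 + p * (u - 1)).
Proof.
move=> /andP[p0 p1] c1 u1 uv.
have u0 : 0 < u by lra.
set t := ln v - ln u.
have tlt : u * t < v - u by exact: ln_chord_lt.
have t0 : 0 < t by rewrite subr_gt0 ltr_ln ?posrE//; lra.
have h1 : 0 <= t * ((1 - p) * (u - 1)).
  by rewrite !mulr_ge0//; lra.
have h2 : 0 <= p * ln u * (v - u).
  by rewrite !mulr_ge0 ?ln_ge0//; lra.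
have h3 : 0 <= (c - 1) * (v - u) by rewrite mulr_ge0//; lra.
rewrite -subr_gt0.
suff -> : (c * (v - 1) - ln v) * (1 + p * (u - 1)) -
    (c * (u - 1) - ln u) * (1 + p * (v - 1)) =
  (c - 1) * (v - u) + p * ln u * (v - u) + t * ((1 - p) * (u - 1))
  + (v - u - u * t) by lra.
by rewrite /t; ring.
Qed.

(** The excess is (1 - p) (v ln v - u ln u) + p u v t - e (v - u), and
    v t > v - u bounds it below by (v - u) (1 - p + p u - e) >= 0. *)
Lemma cross_type1_lt (R : realType) (p e u v : R) : 0 < p < 1 -> e <= 1 ->
  1 <= u -> u < v ->
  (u * ln u - e * (u - 1)) * (1 + p * (v - 1)) <
  (v * ln v - e * (v - 1)) * (1 + p * (u - 1)).
Proof.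
move=> /andP[p0 p1] e1 u1 uv.
have u0 : 0 < u by lra.
set t := ln v - ln u.
have tgt : v - u < v * t by exact: ln_chord_gt.
have h1 : 0 < (1 - p + p * u) * (v * t - (v - u)).
  by rewrite mulr_gt0 ?subr_gt0// addr_gt0 ?mulr_gt0//; lra.
have h2 : 0 <= (1 - p) * ln u * (v - u).
  by rewrite !mulr_ge0 ?ln_ge0//; lra.
have h3 : 0 <= (1 - e) * (v - u) by rewrite mulr_ge0//; lra.
have h4 : 0 <= p * (u - 1) * (v - u) by rewrite !mulr_ge0//; lra.
rewrite -subr_gt0.
suff -> : (v * ln v - e * (v - 1)) * (1 + p * (u - 1)) -
    (u * ln u - e * (u - 1)) * (1 + p * (v - 1)) =
  (1 - p + p * u) * (v * t - (v - u)) + (1 - p) * ln u * (v - u)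
  + (1 - e) * (v - u) + p * (u - 1) * (v - u) by lra.
by rewrite /t; ring.
Qed.

Lemma reduced_cost_increasing (R : realType) (p A B lambda c e m u v : R) :
  0 < p < 1 -> 0 < A -> 0 < B -> 0 <= lambda ->
  1 <= c -> e <= 1 -> p <= m -> 1 <= u -> u < v ->
  reduced_cost p A B lambda c e m u < reduced_cost p A B lambda c e m v.
Proof.
move=> hp A0 B0 l0 c1 e1 pm u1 uv; have /andP[p0 p1] := hp.
have v1 : 1 <= v by lra.
have q0 : 0 < (1 - p) * A by rewrite mulr_gt0//; lra.
have gap0 := @cross_type0_lt R p c u v hp c1 u1 uv.
have gap1 := @cross_type1_lt R p e u v hp e1 u1 uv.
have gap2 : 0 <= lambda * ((m - p) * (v - u)) by rewrite !mulr_ge0//; lra.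
move: gap0 gap1; rewrite -subr_gt0 -(pmulr_rgt0 _ q0) => gap0.
rewrite -subr_gt0 -(pmulr_rgt0 _ (mulr_gt0 p0 B0)) => gap1.
rewrite /reduced_cost ltr_pdivrMr ?mixture_gt0// [ltRHS]mulrAC.
rewrite ltr_pdivlMr ?mixture_gt0// -subr_gt0.
lra.
Qed.

(** * Dependence on the lower threshold *)

Definition lowslope (R : realType) (x : R) : R := - ln x / (1 - x).

Lemma lowslope_ge1 (R : realType) (x : R) : 0 < x < 1 -> 1 <= lowslope x.
Proof.
move=> /andP[x0 x1]; rewrite /lowslope ler_pdivlMr; last by lra.
have := @ln_lt_subr1 R x x0; rewrite lt_eqF// => /(_ isT); lra.
Qed.

Lemma lowslope_mul_le1 (R : realType) (x : R) : 0 < x < 1 ->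
  x * lowslope x <= 1.
Proof.
move=> /andP[x0 x1]; rewrite /lowslope mulrA ler_pdivrMr; last by lra.
by have := @ln_chord_lt R x 1 x0 x1; rewrite ln1; lra.
Qed.

Lemma inv_subr1_ge1 (R : realType) (x : R) : 0 < x < 1 -> 1 <= (1 - x)^-1.
Proof. by move=> /andP[x0 x1]; rewrite -div1r ler_pdivlMr; lra. Qed.

Lemma cost_formulaE (d : measure_display) (T : measurableType d)
    (R : realType) (mu : {measure set T -> \bar R}) (f0 f1 : T -> R)
    (p lambda x u : R) : 0 < p -> 0 < x < 1 -> 1 <= u ->
    0 < fine (KL mu f0 f1) -> 0 < fine (KL mu f1 f0) ->
  cost_formula mu f0 f1 p lambda x u =
  reduced_cost p (fine (KL mu f0 f1))^-1 (fine (KL mu f1 f0))^-1 lambda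
    (lowslope x) (x * lowslope x) (1 - x)^-1 u.
Proof.
rewrite /cost_formula /reduced_cost /lowslope => p0 /andP[x0 x1] u1 D0 D1.
have w0 := @mixture_gt0 R p u p0 u1.
by field; do !(apply/andP; split); lra.
Qed.

Lemma type1_ge0 (R : realType) (e u : R) : e <= 1 -> 1 <= u ->
  0 <= u * ln u - e * (u - 1).
Proof.
move=> e1 u1; have h0 := mulr_ln_ge_subr1 u1.
have h1 : 0 <= (1 - e) * (u - 1) by rewrite mulr_ge0//; lra.
lra.
Qed.

(** The two lower bounds below isolate the summand that diverges at [dL = 0]
    and at [dL = 1] respectively; the summands left out are nonnegative because
    [u ln u >= u - 1 >= ln u]. *)
Lemma reduced_cost_ge_type0 (R : realType) (p A B lambda c e m u : R) :
  0 < p < 1 -> 0 < A -> 0 < B -> 0 <= lambda -> e <= 1 -> 0 <= m -> 1 <= u ->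
  (1 - p) * A * (c * (u - 1) - ln u) / (1 + p * (u - 1))
    <= reduced_cost p A B lambda c e m u.
Proof.
move=> /andP[p0 p1] A0 B0 l0 e1 m0 u1.
rewrite ler_pM2r ?invr_gt0 ?mixture_gt0//.
have h2 : 0 <= p * B * (u * ln u - e * (u - 1)).
  by rewrite !mulr_ge0 ?type1_ge0//; lra.
have h3 : 0 <= lambda * (1 + m * (u - 1)).
  by rewrite mulr_ge0// addr_ge0// mulr_ge0//; lra.
lra.
Qed.

Lemma reduced_cost_ge_switch (R : realType) (p A B lambda c e m u : R) :
  0 < p < 1 -> 0 < A -> 0 < B -> 0 <= lambda -> 1 <= c -> e <= 1 -> 1 <= u ->
  lambda * (1 + m * (u - 1)) / (1 + p * (u - 1))
    <= reduced_cost p A B lambda c e m u.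
Proof.
move=> /andP[p0 p1] A0 B0 l0 c1 e1 u1.
rewrite ler_pM2r ?invr_gt0 ?mixture_gt0//.
have h2 : 0 <= p * B * (u * ln u - e * (u - 1)).
  by rewrite !mulr_ge0 ?type1_ge0//; lra.
have h3 : ln u <= u - 1.
  by have := @le_ln1Dx R (u - 1); rewrite subrKC; apply; lra.
have h4 : 0 <= (c - 1) * (u - 1) by rewrite mulr_ge0//; lra.
have h5 : 0 <= (1 - p) * A * (c * (u - 1) - ln u) by rewrite !mulr_ge0//; lra.
lra.
Qed.

(** * The cost at the endpoints of the lower threshold *)

Lemma lowslope_cvgy (R : realType) : @lowslope R x @[x --> 0^'+] --> +oo.
Proof.
apply: (@ger_cvgy _ _ _ _ (fun x : R => - ln x)); last first.
  by apply/cvgNry; exact: lnNy.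
near=> x.
have x0 : 0 < x by near: x; exact: nbhs_right_gt.
have x1 : x < 1 by near: x; exact: nbhs_right_lt.
rewrite /lowslope ler_pdivlMr; last by lra.
by have := @ln_le0 R x (ltW x1) => ?; nra.
Unshelve. all: by end_near. Qed.

Lemma lowslope_cvg1 (R : realType) : @lowslope R x @[x --> 1^'-] --> (1 : R).
Proof.
apply: (@squeeze_cvgr _ _ _ _ (fun=> 1 : R) (fun x : R => x^-1)).
- near=> x.
  have x0 : 0 < x by near: x; exact: nbhs_left_gt.
  have x1 : x < 1 by near: x; exact: nbhs_left_lt.
  have hx : 0 < x < 1 by rewrite x0.
  rewrite lowslope_ge1//= -div1r ler_pdivlMr// mulrC.
  exact: lowslope_mul_le1.
- exact: cvg_cst.
- apply: cvg_at_left_filter; rewrite -[X in _ --> X]invr1.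
  by apply: cvgV => //; rewrite oner_neq0.
Unshelve. all: by end_near. Qed.

Lemma inv_subr1_cvgy (R : realType) :
  (1 - x : R)^-1 @[x --> (1 : R)^'-] --> +oo.
Proof.
apply/cvgryPge => M.
(* [|M| + 1] is a positive threshold dominating [M], so that it can be
   inverted. *)
have M0 : 0 < `|M| + 1 by rewrite ltr_wpDl.
near=> x.
have x1 : x < 1 by near: x; exact: nbhs_left_lt.
have : 1 - x < (`|M| + 1)^-1.
  by near: x; apply: nbhs_left_ltBl; rewrite invr_gt0.
rewrite -[X in X < _]invrK ltf_pV2 ?posrE ?invr_gt0//; last by lra.
by have := ler_norm M; lra.
Unshelve. all: by end_near. Qed.

Lemma cvgy_affine (R : realType) (I : Type) (F : set_system I) (FF : Filter F)
    (f : I -> R) (a b : R) : 0 < a ->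
  f i @[i --> F] --> +oo -> a * f i + b @[i --> F] --> +oo.
Proof.
move=> a0 /cvgryPge fy; apply/cvgryPge => M.
apply: filterS (fy ((M - b) / a)) => i.
by rewrite ler_pdivrMr// mulrC -lerBlDr.
Qed.

Lemma cost_at0 (d : measure_display) (T : measurableType d)
    (R : realType) (mu : {measure set T -> \bar R}) (f0 f1 : T -> R)
    (p lambda u : R) : 0 < p < 1 -> 0 <= lambda -> 1 < u ->
    0 < fine (KL mu f0 f1) -> 0 < fine (KL mu f1 f0) ->
  cost mu f0 f1 p lambda 0 u = +oo%E.
Proof.
move=> hp l0 u1 D0 D1; have /andP[p0 p1] := hp; rewrite /cost eqxx.
have w0 : 0 < 1 + p * (u - 1) by rewrite mixture_gt0// ltW.
set A := (fine (KL mu f0 f1))^-1.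
have A0 : 0 < A by rewrite invr_gt0.
apply/cvg_lim => //; apply/cvgeryP.
pose k := (1 - p) * A / (1 + p * (u - 1)).
have k0 : 0 < k by rewrite divr_gt0// mulr_gt0//; lra.
apply: (@ger_cvgy _ _ _ _ (fun x => (k * (u - 1)) * lowslope x + k * - ln u)).
  near=> x.
  have x0 : 0 < x by near: x; exact: nbhs_right_gt.
  have x1 : x < 1 by near: x; exact: nbhs_right_lt.
  have hx : 0 < x < 1 by rewrite x0.
  rewrite cost_formulaE//; last exact: ltW.
  apply: le_trans; last first.
    apply: reduced_cost_ge_type0; rewrite ?invr_gt0 ?lowslope_mul_le1//.
    - by rewrite ltW// invr_gt0; lra.
    - exact: ltW.
  by rewrite le_eqVlt; apply/orP; left; apply/eqP; rewrite /k -/A; field; lra.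
by apply: cvgy_affine; [rewrite mulr_gt0//; lra|exact: lowslope_cvgy].
Unshelve. all: by end_near. Qed.

Lemma cost_at1_switch (d : measure_display) (T : measurableType d)
    (R : realType) (mu : {measure set T -> \bar R}) (f0 f1 : T -> R)
    (p lambda u : R) : 0 < p < 1 -> 0 < lambda -> 1 < u ->
    0 < fine (KL mu f0 f1) -> 0 < fine (KL mu f1 f0) ->
  cost mu f0 f1 p lambda 1 u = +oo%E.
Proof.
move=> hp l0 u1 D0 D1; have /andP[p0 p1] := hp.
rewrite /cost oner_eq0 eqxx.
have w0 : 0 < 1 + p * (u - 1) by rewrite mixture_gt0// ltW.
apply/cvg_lim => //; apply/cvgeryP.
pose k := lambda / (1 + p * (u - 1)).
have k0 : 0 < k by rewrite divr_gt0.
apply: (@ger_cvgy _ _ _ _ (fun x => (k * (u - 1)) * (1 - x)^-1 + k)).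
  near=> x.
  have x0 : 0 < x by near: x; exact: nbhs_left_gt.
  have x1 : x < 1 by near: x; exact: nbhs_left_lt.
  have hx : 0 < x < 1 by rewrite x0.
  rewrite cost_formulaE//; last exact: ltW.
  apply: le_trans; last first.
    by apply: reduced_cost_ge_switch;
      rewrite ?invr_gt0 ?lowslope_mul_le1 ?lowslope_ge1// ltW.
  rewrite le_eqVlt; apply/orP; left; apply/eqP; rewrite /k; field.
  by apply/andP; split; lra.
by apply: cvgy_affine; [rewrite mulr_gt0//; lra|exact: inv_subr1_cvgy].
Unshelve. all: by end_near. Qed.

(** Without switching cost the coefficient [m], which diverges, is multiplied
    by 0; the value 1 given to it in the limit is arbitrary. *)
Lemma cost_at1_noswitch (d : measure_display) (T : measurableType d)
    (R : realType) (mu : {measure set T -> \bar R}) (f0 f1 : T -> R)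
    (p u : R) : 0 < p < 1 -> 1 <= u ->
    0 < fine (KL mu f0 f1) -> 0 < fine (KL mu f1 f0) ->
  cost mu f0 f1 p 0 1 u =
  (reduced_cost p (fine (KL mu f0 f1))^-1 (fine (KL mu f1 f0))^-1 0 1 1 1 u)%:E.
Proof.
move=> hp u1 D0 D1; have /andP[p0 p1] := hp.
rewrite /cost oner_eq0 eqxx.
set A := (fine (KL mu f0 f1))^-1; set B := (fine (KL mu f1 f0))^-1.
apply/cvg_lim => //; apply: cvg_EFin; first by near=> x.
have c1 := @lowslope_cvg1 R.
have e1 : x * lowslope x @[x --> (1 : R)^'-] --> (1 : R).
  rewrite -[X in _ --> X]mulr1; apply: cvgM => //.
  by apply: cvg_at_left_filter; exact: cvg_id.
apply: (@cvg_trans _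
    (reduced_cost p A B 0 (lowslope x) (x * lowslope x) 1 u @[x --> 1^'-])).
  apply: near_eq_cvg; near=> x.
  have x0 : 0 < x by near: x; exact: nbhs_left_gt.
  have x1 : x < 1 by near: x; exact: nbhs_left_lt.
  rewrite /= cost_formulaE//; last by rewrite x0.
  by rewrite /reduced_cost !mul0r.
rewrite /reduced_cost; apply: cvgMl.
apply: cvgD; last exact: cvg_cst.
apply: cvgD; apply: cvgMr.
- by apply: cvgB; [exact: cvgMl|exact: cvg_cst].
- by apply: cvgB; [exact: cvg_cst|exact: cvgMl].
Unshelve. all: by end_near. Qed.

(** * The optimal upper threshold *)

Lemma cost_interior (d : measure_display) (T : measurableType d)
    (R : realType) (mu : {measure set T -> \bar R}) (f0 f1 : T -> R)
    (p lambda x u : R) : 0 < x < 1 ->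
  cost mu f0 f1 p lambda x u = (cost_formula mu f0 f1 p lambda x u)%:E.
Proof. by move=> /andP[x0 x1]; rewrite /cost gt_eqF// lt_eqF. Qed.

Lemma cost_increasing (d : measure_display) (T : measurableType d)
    (R : realType) (mu : {measure set T -> \bar R}) (f0 f1 : T -> R)
    (p lambda x u v : R) : 0 < p < 1 -> 0 <= lambda ->
    0 < fine (KL mu f0 f1) -> 0 < fine (KL mu f1 f0) ->
    0 < x < 1 -> 1 <= u -> u < v ->
  (cost mu f0 f1 p lambda x u < cost mu f0 f1 p lambda x v)%E.
Proof.
move=> hp l0 D0 D1 hx u1 uv; have /andP[p0 p1] := hp.
rewrite !cost_interior// lte_fin !cost_formulaE//; last by lra.
apply: reduced_cost_increasing;
  rewrite ?invr_gt0 ?lowslope_mul_le1 ?lowslope_ge1//.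
by apply: le_trans (ltW p1) _; exact: inv_subr1_ge1.
Qed.

(** The feasible upper thresholds exceed 1 exactly because the odds
    (1 - p) / p and (1 - eps) / eps have product larger than 1 when
    eps + p < 1. *)
Lemma threshold_gt1 (R : realType) (p eps : R) : 0 < p -> 0 < eps ->
  eps < 1 - p -> 1 < (1 - p) / p * ((1 - eps) / eps).
Proof.
move=> p0 e0 ep; rewrite mulrACA -invfM ltr_pdivlMr ?mulr_gt0//.
by lra.
Qed.

Theorem proposition1 (d : measure_display) (T : measurableType d)
    (R : realType) (mu : {measure set T -> \bar R}) (f0 f1 : T -> R)
    (p eps lambda : R)
    (hp : 0 < p < 1) (heps : 0 < eps < 1) (hepsp : eps < 1 - p)
    (hlambda : 0 <= lambda)
    (hf0 : is_density mu f0) (hf1 : is_density mu f1)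
    (hdistinct : exists2 A : set T, measurable A &
      distribution_of_density mu f0 A <> distribution_of_density mu f1 A)
    (hD01 : (0 < KL mu f0 f1 < +oo)%E) (hD10 : (0 < KL mu f1 f0 < +oo)%E) :
  (forall dL : R, 0 < dL < 1 ->
     forall u v : R, 1 <= u -> u < v ->
       (cost mu f0 f1 p lambda dL u < cost mu f0 f1 p lambda dL v)%E)
  /\
  (forall dL dU : R, is_solution mu f0 f1 p eps lambda dL dU ->
     dU = (1 - p) / p * ((1 - eps) / eps)).
Proof.
have D0 : 0 < fine (KL mu f0 f1) by exact: fine_gt0.
have D1 : 0 < fine (KL mu f1 f0) by exact: fine_gt0.
split=> [x hx u v u1 uv|x u [[bu /andP[x0 x1]] umin]].
  exact: cost_increasing.
have /andP[p0 p1] := hp; have /andP[e0 _] := heps.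
have b1 := @threshold_gt1 R p eps p0 e0 hepsp.
set b := _ * _ in bu b1 *.
apply/eqP; rewrite eq_le bu andbT leNgt; apply/negP => ltbu.
have u1 : 1 < u by exact: lt_trans ltbu.
have not_better dL : 0 <= dL <= 1 ->
    ~ (cost mu f0 f1 p lambda dL b < cost mu f0 f1 p lambda x u)%E.
  by move=> hdL; apply/negP; rewrite -leNgt; apply: umin; split.
have finite : cost mu f0 f1 p lambda x u <> +oo%E.
  move=> xoo; apply: (not_better 2^-1); first by apply/andP; split; lra.
  by rewrite xoo cost_interior ?ltry//; apply/andP; split; lra.
move: x0; rewrite le_eqVlt => /predU1P[x0|x0].
  by apply: finite; rewrite -x0; exact: cost_at0.
move: (x1); rewrite le_eqVlt => /predU1P[xE|xlt1]; last first.
  by apply: (not_better x); [rewrite ltW|apply: cost_increasing; rewrite ?x0// ltW].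
move: hlambda; rewrite le_eqVlt => /predU1P[l0|l0].
  apply: (not_better 1); first by rewrite ler01 lexx.
  rewrite xE -l0 !cost_at1_noswitch// ?(ltW b1) ?(ltW u1)// lte_fin.
  by apply: reduced_cost_increasing; rewrite ?invr_gt0// ltW.
by apply: finite; rewrite xE; exact: cost_at1_switch.
Qed.
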